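(* There exist a universal constant $C>0$ and a function $q\mapsto C_q$ from $(2,\infty)$ to $(1,\infty)$ such that the following is true. Let $n\in\mathbb{N}$, $2<q<\infty$, let $a\in\mathbb{R}^n$ with $a\neq 0$, and let $(X_i)_{i=1}^n$ be a sequence of independent (real valued) random variables such that for all $1\le i\le n$ and all $t>0$, $$\mathbb{P}\{|X_i|>t\}\leq 2(1+t)^{-q}.$$ Then for all $t>0$, $$\mathbb{P}\left\{\left|\sum_{i=1}^n a_iX_i-\mathbb{E}\sum_{i=1}^n a_iX_i\right|>C_q\left(t|a|_2+e^{t^2/(2q)}|a|_q\right)\right\}\leq Ce^{-t^2/2}.$$
   Context: For $p\geq 1$ and $a\in\mathbb{R}^n$, $|a|_p=\left(\sum_{i=1}^n|a_i|^p\right)^{1/p}$ is the $\ell_p^n$ norm. The constant $C$ is universal and $C_q$ depends only on $q$. The random variables are not assumed to be identically distributed or symmetric. *)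

(* Defs.v *)
From mathcomp Require Import all_boot all_order all_algebra.
From mathcomp Require Import all_classical all_reals all_analysis.

Set Implicit Arguments.
Unset Strict Implicit.
Unset Printing Implicit Defensive.

Import Order.TTheory GRing.Theory Num.Theory.
Import numFieldNormedType.Exports.

Local Open Scope classical_set_scope.
Local Open Scope ring_scope.

Definition lp_norm (R : realType) (n : nat) (p : R) (a : 'rV[R]_n) : R :=
  (\sum_(i < n) `|a 0 i| `^ p) `^ p^-1.

Definition independent_RVs (d d' : measure_display) (T : measurableType d)
    (T' : measurableType d') (R : realType) (P : probability T R)
    (I : finType) (X : I -> {RV P >-> T'}) : Prop :=
  forall (J : {set I}) (A : I -> set T'),
    (forall i, i \in J -> measurable (A i)) ->
    P (\bigcap_(i in [set` J]) (X i @^-1` A i)) =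
    (\prod_(i in J) P (X i @^-1` A i))%E.

Arguments independent_RVs {d d' T T' R} P {I} X.

(* Main.v *)
(* A one-sided Fuk-Nagaev argument, applied to [a] and to [- a]. Truncate from
   above at M = e^{t^2/(2q)} |a|_q: a union bound shows that some a_i X_i exceeds
   M with probability at most 2 e^{-t^2/2}, and truncating from above only lowers
   the mean, so no centering correction arises. For the truncated variables,
   e^{l z} <= 1 + l z + e^{2q} (l z)^2 as long as l z <= 2q, while beyond that
   point e^{l z} <= e^{l M} (z/M)^{2q}. The exponent 2q (rather than q) makes the
   corresponding clipped moment converge under a mere weak-L^q assumption, with
   the universal bound 8 (|a_i|/M)^q; summed over i it contributes
   8 e^{l M - t^2/2}, which is at most 8 when l M <= t^2/2. This is why C does not
   depend on q. Chernoff's bound with l = min(t/|a|_2, t^2/(2M)) concludes. *)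
Require Import Defs.
From mathcomp Require Import all_boot all_order all_algebra.
From mathcomp Require Import all_classical all_reals all_analysis.
From mathcomp Require Import measurable_realfun ring lra.

Import Order.TTheory GRing.Theory Num.Theory.
Import numFieldNormedType.Exports.

Local Open Scope classical_set_scope.
Local Open Scope ring_scope.

(** * Pointwise bounds for the exponential of a truncated variable *)

(** Multiplying e^{-x} >= 1 - x by e^x gives e^x - 1 <= x + x (e^x - 1), so only x (e^x - 1) has to
    be bounded. For x >= 0 the same inequality is used again; for x < 0 one has 1 - e^x <= -x. *)
Lemma expR_le_quadratic (R : realType) (x r : R) : 0 <= r -> x <= r ->
  expR x <= 1 + x + expR r * x ^+ 2.
Proof.
move=> r0 xr.
have H : expR x - 1 <= x * expR x.
  have h := expR_ge1Dx (- x); have e := expR_gt0 x.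
  have : expR x * (1 - x) <= expR x * expR (- x) by rewrite ler_pM2l.
  rewrite expRxMexpNx_1; lra.
have er1 : 1 <= expR r by rewrite -expR0 ler_expR.
have [x0|x0] := leP 0 x.
  have h : expR x <= expR r by rewrite ler_expR.
  suff : x * (expR x - 1) <= x * (expR r * x) by rewrite expr2; lra.
  apply: ler_wpM2l => //; apply: le_trans H _.
  by rewrite mulrC ler_wpM2r.
have h1 := expR_ge1Dx x.
suff : (- x) * (1 - expR x) <= x ^+ 2 * expR r by lra.
apply: (@le_trans _ _ (x ^+ 2)); last by rewrite ler_peMr// sqr_ge0.
have -> : x ^+ 2 = (- x) * (- x) by rewrite mulrNN expr2.
by apply: ler_wpM2l; lra.
Qed.

(** After taking logarithms the claim is r ln(M/z) <= l (M - z) = l z (M/z - 1), which follows from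
    ln u <= u - 1 and r <= l z. *)
Lemma expR_le_powR (R : realType) (l z M r : R) : 0 < z -> z <= M -> 0 <= r ->
  r <= l * z -> expR (l * z) <= expR (l * M) * (z / M) `^ r.
Proof.
move=> z0 zM r0 rlz; have M0 : 0 < M by lra.
have zM0 : 0 < z / M by rewrite divr_gt0.
have Mz0 : 0 < M / z by rewrite divr_gt0.
rewrite /powR gt_eqF// -expRD ler_expR.
have -> : ln (z / M) = - ln (M / z) by rewrite -lnV ?posrE// invf_div.
have h : ln (M / z) <= M / z - 1.
  have := ln_sublinear Mz0.
  have := expR_ge1Dx (ln (M / z)); rewrite lnK ?posrE//; lra.
have : r * ln (M / z) <= (l * z) * (M / z - 1).
  apply: (@le_trans _ _ (r * (M / z - 1))); first exact: ler_wpM2l.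
  apply: ler_wpM2r => //.
  by rewrite subr_ge0 ler_pdivlMr ?mul1r.
have -> : l * z * (M / z - 1) = l * M - l * z by field; rewrite gt_eqF.
lra.
Qed.

(** The linear and quadratic terms carry [y] itself rather than its truncation, so that taking
    expectations produces the true mean and second moment. *)
Lemma expR_minr_le (R : realType) (l y M q : R) : 0 < l -> 0 < M -> 0 < q ->
  expR (l * Num.min y M) <= 1 + l * y + expR (2 * q) * l ^+ 2 * y ^+ 2
     + expR (l * M) * (Num.min 1 ((`|y| / M) `^ q)) ^+ 2.
Proof.
move=> l0 M0 q0; set z := Num.min y M.
have zy : z <= y by rewrite /z ge_min lexx.
have zM : z <= M by rewrite /z ge_min lexx orbT.
(* Truncation from above at a positive level never increases the absolute value. *)
have zy2 : z ^+ 2 <= y ^+ 2.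
  rewrite /z /Num.min; case: ifPn => // /[!(@ltNge _ R)] /negPn My.
  by rewrite ler_sqr ?nnegrE; lra.
have E0 : 0 <= expR (l * M) * (Num.min 1 ((`|y| / M) `^ q)) ^+ 2.
  by rewrite mulr_ge0 ?expR_ge0 ?sqr_ge0.
(* Below the threshold 2q the quadratic bound applies with r = 2q; above it, z is positive and the
   power bound applies with the exponent 2q. *)
have [h|h] := leP (l * z) (2 * q).
  have := expR_le_quadratic _ _ (2 * q) ltac:(lra) h.
  have : l * z <= l * y by rewrite ler_pM2l.
  have : expR (2 * q) * (l * z) ^+ 2 <= expR (2 * q) * l ^+ 2 * y ^+ 2.
    by rewrite exprMn mulrA ler_wpM2l// mulr_ge0 ?expR_ge0 ?sqr_ge0.
  lra.
have z0 : 0 < z by rewrite -(pmulr_rgt0 z l0); lra.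
have ly : 0 <= l * y by rewrite mulr_ge0; lra.
have Q0 : 0 <= expR (2 * q) * l ^+ 2 * y ^+ 2.
  by rewrite mulr_ge0 ?sqr_ge0// mulr_ge0 ?sqr_ge0 ?expR_ge0.
have zq : (z / M) `^ q <= Num.min 1 ((`|y| / M) `^ q).
  have zM0 : 0 <= z / M by rewrite divr_ge0; lra.
  rewrite le_min; apply/andP; split.
    have <- : 1 `^ q = 1 :> R by rewrite powR1.
    rewrite ge0_ler_powR ?nnegrE ?(ltW q0)//.
    by rewrite ler_pdivrMr// mul1r.
  apply: ge0_ler_powR; rewrite ?nnegrE ?(ltW q0)//.
    by rewrite divr_ge0 ?(ltW M0).
  by rewrite ler_pM2r ?invr_gt0// (le_trans zy)// ler_norm.
have h1 := expR_le_powR _ l z M (2 * q) z0 zM ltac:(lra) (ltW h).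
apply: le_trans h1 _; rewrite [X in _ `^ X]mulrC powRrM powR_mulrn ?powR_ge0//.
apply: (@le_trans _ _ (expR (l * M) * (Num.min 1 ((`|y| / M) `^ q)) ^+ 2)).
  rewrite ler_wpM2l ?expR_ge0// lerXn2r ?nnegrE ?powR_ge0//.
  by rewrite le_min ler01 powR_ge0.
by rewrite lerDr; lra.
Qed.

(** * Moment bounds from the tail, by dyadic decomposition *)

(** Picks the dyadic layer of a value; layer 0 absorbs everything below 2, hence has no lower
    bound. *)
Lemma dyadic_bracket (R : realType) (x : R) :
  exists k : nat, x < 2 ^+ k.+1 /\ (k = 0%N \/ 2 ^+ k <= x).
Proof.
have H : exists n : nat, x < 2 ^+ n.+1.
  exists (Num.truncn x); apply: (lt_trans (truncnS_gt x)).
  by rewrite -natrX ltr_nat ltn_expl.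
case: (ex_minnP H) => k xk kmin; exists k; split=> //.
case: k xk kmin => [|k] xk kmin; [by left|right].
by rewrite leNgt; apply/negP => /kmin; rewrite ltnn.
Qed.

(** [W] is dominated pointwise by the series of [c k] times the indicator of [A k]. Integrating term
    by term leaves a geometric series. Both moment bounds below are instances. *)
Lemma ge0_integral_le_geometric (d : measure_display) (T : measurableType d)
    (R : realType) (P : probability T R) (W : T -> R) (A : nat -> set T)
    (c : nat -> R) (C r : R) :
  measurable_fun setT W -> (forall w, 0 <= W w) ->
  (forall k, measurable (A k)) -> (forall k, 0 <= c k) ->
  0 <= C -> 0 <= r < 1 ->
  (forall w, 0 < W w -> exists2 k, A k w & W w <= c k) ->
  (forall k, (c k)%:E * P (A k) <= (C * r ^+ k)%:E)%E ->
  (\int[P]_w (W w)%:E <= (C / (1 - r))%:E)%E.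
Proof.
move=> mW W0 mA c0 C0 /andP[r0 r1] WA cA.
pose F (k : nat) w := (c k * \1_(A k) w)%:E.
have mF k : measurable_fun setT (F k).
  by apply/measurable_EFinP; exact: measurable_funM.
have F0 k w : setT w -> (0 <= F k w)%E by move=> _; rewrite lee_fin mulr_ge0.
apply: (@le_trans _ _ (\int[P]_w (\sum_(0 <= k <oo) F k w))%E).
  apply: ge0_le_integral => //.
  - by move=> w _; rewrite lee_fin.
  - exact/measurable_EFinP.
  - by apply: ge0_emeasurable_sum => // k w _ _; exact: F0.
  move=> w _; have [Ww|] := ltP 0 (W w); last first.
    move=> Ww; apply: (@le_trans _ _ 0%E); first by rewrite lee_fin.
    by apply: nneseries_ge0 => k _ _; exact: F0.
  have [k Ak Wc] := WA _ Ww.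
  apply: le_trans (nneseries_lim_ge k.+1 _); last by move=> j _ _; exact: F0.
  rewrite big_nat_recr//= -[leLHS]add0e; apply: leeD.
    by rewrite sume_ge0// => j _; exact: F0.
  by rewrite lee_fin indicE mem_set// mulr1.
rewrite integral_nneseries//.
apply: (@le_trans _ _ (\sum_(0 <= k <oo) (C * r ^+ k)%:E)%E).
  apply: lee_nneseries => k; first by move=> _ _; exact: integral_ge0 (F0 k).
  move=> _; rewrite /F; under eq_integral do rewrite EFinM.
  rewrite ge0_integralZl_EFin//; first by rewrite integral_indic ?setIT.
  exact/measurable_EFinP/measurable_indic.
apply: lime_le.
  by apply: is_cvg_nneseries => k _ _; rewrite lee_fin mulr_ge0// exprn_ge0.
apply: nearW => n; rewrite sumEFin lee_fin.
have -> : \sum_(0 <= i < n) C * r ^+ i = series (geometric C r) n by [].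
rewrite geometric_seriesE ?lt_eqF//= ler_pM2r ?invr_gt0 ?subr_gt0//.
by rewrite ler_piMr// gerBl exprn_ge0.
Qed.

Definition heavy_tailed {d : measure_display} {T : measurableType d}
    {R : realType} (P : probability T R) (q : R) (X : T -> R) :=
  forall t : R, 0 < t ->
    (P [set w | (t < `|X w|)%R] <= (2 * (1 + t) `^ (- q))%:E)%E.

Lemma measurable_preimage_gt (d : measure_display) (T : measurableType d)
    (R : realType) (f : T -> R) (c : R) :
  measurable_fun setT f -> measurable [set w | c < f w].
Proof.
move=> mf; have := mf measurableT _ (measurable_itv `]c, +oo[); rewrite setTI.
congr (measurable _); apply/seteqP; split=> w /=; rewrite in_itv/= andbT//.
Qed.

Lemma measurable_preimage_ge (d : measure_display) (T : measurableType d)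
    (R : realType) (f : T -> R) (c : R) :
  measurable_fun setT f -> measurable [set w | c <= f w].
Proof.
move=> mf; have := mf measurableT _ (measurable_itv `[c, +oo[); rewrite setTI.
congr (measurable _); apply/seteqP; split=> w /=; rewrite in_itv/= andbT//.
Qed.

Lemma measurable_tail (d : measure_display) (T : measurableType d)
    (R : realType) (P : probability T R) (X : {RV P >-> R}) (s : R) :
  measurable [set w | s <= `|X w|].
Proof.
by apply: measurable_preimage_ge; exact: measurableT_comp.
Qed.

(* The shift in the hypothesis, applied at [t = s - 1], turns the strict tail
   into a weak one without any loss; for [s <= 1] the bound exceeds 1. *)
Lemma weak_tail (d : measure_display) (T : measurableType d)
    (R : realType) (P : probability T R) (q : R) (X : {RV P >-> R}) (s : R) :
  2 < q -> heavy_tailed P q X -> 0 < s ->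
  (P [set w | (s <= `|X w|)%R] <= (2 * s `^ (- q))%:E)%E.
Proof.
move=> q2 tailX s0; have [s1|s1] := leP s 1.
  apply: (@le_trans _ _ 1%E); first exact/probability_le1/measurable_tail.
  rewrite lee_fin powRN -ler_pdivrMl// mulr1 lef_pV2 ?posrE ?powR_gt0//.
  apply: (@le_trans _ _ 1); last by rewrite ler1n.
  have <- : 1 `^ q = 1 :> R by rewrite powR1.
  by apply: ge0_ler_powR; rewrite ?nnegrE; lra.
have := tailX (s - 1) ltac:(lra); rewrite (_ : 1 + (s - 1) = s); last by ring.
apply: le_trans; apply: le_measure; rewrite ?inE.
- exact: measurable_tail.
- by apply: measurable_preimage_gt; exact: measurableT_comp.
- by move=> w /=; lra.
Qed.
(** On layer k the square is at most 4^{k+1} and the tail at 2^k is at most 2 * 2^{-kq}, so the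
    layer contributes at most 8 * (2^{2-q})^k, with ratio below 1 because q > 2. *)
Lemma heavy_tailed_second_moment (d : measure_display) (T : measurableType d)
    (R : realType) (P : probability T R) (q : R) (X : {RV P >-> R}) :
  2 < q -> heavy_tailed P q X ->
  (\int[P]_w (X w ^+ 2)%:E <= (8 / (1 - 2 `^ (2 - q)))%:E)%E.
Proof.
move=> q2 tailX.
(* Layer 0 is given the whole space; its cost 4 fits under the leading constant 8. *)
pose A k := if k == 0%N then setT else [set w | 2 ^+ k <= `|X w|].
apply: (@ge0_integral_le_geometric _ _ _ _ _ A (fun k => 4 ^+ k.+1)) => //.
- exact: measurable_funX.
- by move=> w; exact: sqr_ge0.
- by rewrite /A => -[|k] //=; exact: measurable_tail.
- apply/andP; split; first exact: powR_ge0.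
  by rewrite /powR pnatr_eq0/= expR_lt1 pmulr_llt0 ?ln_gt0 ?ltr1n//; lra.
- move=> w _; have [k [Xk k0]] := dyadic_bracket _ `|X w|.
  exists k; first by rewrite /A; case: k Xk k0 => [|k] //= _ [].
  rewrite -real_normK ?num_real// -[4](_ : 2 ^+ 2 = _) -?exprM 1?mulnC ?exprM.
    by rewrite ler_sqr ?nnegrE ?exprn_ge0// ltW.
  by rewrite -natrX.
move=> [|k].
  rewrite /A/= probability_setT mule1 lee_fin expr1 expr0; lra.
rewrite {}/A/=; set m := k.+1.
apply: (@le_trans _ _ ((4 ^+ m.+1)%:E * (2 * (2 ^+ m) `^ (- q))%:E)%E).
  by apply: lee_pmul => //; apply: (weak_tail _ _ _ P) => //; rewrite exprn_gt0.
rewrite -EFinM lee_fin powRD ?pnatr_eq0 ?implybT// exprMn.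
have -> : (2 ^+ m) `^ (- q) = (2 `^ (- q)) ^+ m :> R.
  by rewrite -(powR_mulrn m (powR_ge0 2 (- q)))
    -(powR_mulrn m (ler0n _ 2)) powRAC.
have -> : 2 `^ 2 = 4 :> R by rewrite powR_mulrn// -natrX.
by rewrite exprS; lra.
Qed.

(** For u = rho |X|^q the tail gives only P(u >= v) <= 2 rho / v, which does not make u integrable.
    Clipping at 1 removes large values, and on u of order 2^{-k} the square 4^{-k} beats the
    probability 4 rho 2^k, leaving 4 rho 2^{-k}. *)
Lemma heavy_tailed_clipped_moment (d : measure_display) (T : measurableType d)
    (R : realType) (P : probability T R) (q : R) (X : {RV P >-> R})
    (rho : R) :
  2 < q -> heavy_tailed P q X -> 0 <= rho ->
  (\int[P]_w ((Num.min 1 (rho * `|X w| `^ q)) ^+ 2)%:E <= (8 * rho)%:E)%E.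
Proof.
move=> q2 tailX; rewrite le_eqVlt => /predU1P[<-|rho0].
  under eq_integral do rewrite mul0r (min_idPr _)// expr0n.
  by rewrite integral0 mulr0.
have -> : 8 * rho = 4 * rho / (1 - 2^-1) by field.
pose A k := [set w | (2 ^+ k.+1)^-1 <= rho * `|X w| `^ q].
have mV : measurable_fun setT (fun w => rho * `|X w| `^ q).
  apply: measurable_funM => //.
  apply: (measurableT_comp (measurable_powR q)) => //.
  exact: measurableT_comp.
have mA k : measurable (A k).
  exact: measurable_preimage_ge.
apply: (@ge0_integral_le_geometric _ _ _ _ _ A
  (fun k => (2 ^+ k)^-1 ^+ 2)) => //.
- by apply: measurable_funX; exact: measurable_minr.
- by move=> w; exact: sqr_ge0.
- lra.
- lra.
- move=> w; set u := rho * _ => h.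
  have u0 : 0 < u.
    rewrite lt_neqAle [0 <= u]mulr_ge0 ?powR_ge0 ?(ltW rho0)// andbT.
    apply: contraTN h => /eqP <-.
    by rewrite (min_idPr _)// expr0n ltxx.
  (* Bracketing 1/u makes the layers descend to 0; in layer 0, where u > 1/2, the clip at 1 supplies
     the upper bound. *)
  have [k [uk k0]] := dyadic_bracket _ u^-1.
  exists k.
    by rewrite /A/= -/u invf_ple ?posrE ?exprn_gt0// ltW.
  rewrite ler_sqr ?nnegrE ?invr_ge0 ?exprn_ge0 ?le_min ?ler01 ?(ltW u0)//.
  rewrite ge_min; case: k0 => [->|k0]; first by rewrite expr0 invr1 lexx.
  apply/orP; right.
  by rewrite -[leLHS]invrK lef_pV2 ?posrE ?invr_gt0 ?exprn_gt0.
move=> k; set v := (rho * 2 ^+ k.+1)^-1.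
have v0 : 0 < v by rewrite invr_gt0 mulr_gt0 ?exprn_gt0.
have q0 : 0 < q by lra.
apply: (@le_trans _ _
  (((2 ^+ k)^-1 ^+ 2)%:E * (2 * (v `^ q^-1) `^ (- q))%:E)%E).
  apply: lee_pmul => //.
  apply: le_trans (weak_tail _ _ _ _ _ _ _ q2 tailX (powR_gt0 q^-1 v0)).
  apply: le_measure; rewrite ?inE//; first exact: measurable_tail.
  rewrite /A => w /=; rewrite -ler_pdivrMl// -invfM -/v => vX.
  have -> : `|X w| = (`|X w| `^ q) `^ q^-1.
    by rewrite -powRrM divff ?powRr1// gt_eqF.
  apply: ge0_ler_powR => //; first by rewrite invr_ge0 ltW.
    by rewrite nnegrE ltW.
  by rewrite nnegrE powR_ge0.
rewrite -EFinM lee_fin -powRrM mulrN mulVf ?gt_eqF//.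
rewrite powR_inv1 ?(ltW v0)// /v invrK.
have -> : 2^-1 ^+ k = (2 ^+ k)^-1 :> R by rewrite exprVn.
have : 2 ^+ k != 0 :> R by rewrite expf_neq0.
rewrite [2 ^+ k.+1]exprS; move: (2 ^+ k) => x x0.
by rewrite le_eqVlt; apply/orP; left; apply/eqP; field.
Qed.

Lemma heavy_tailed_integrable (d : measure_display) (T : measurableType d)
    (R : realType) (P : probability T R) (q : R) (X : {RV P >-> R}) :
  2 < q -> heavy_tailed P q X -> P.-integrable setT (EFin \o X).
Proof.
move=> q2 tailX.
have mX2 : measurable_fun setT (fun w => X w ^+ 2) by exact: measurable_funX.
have iX2 : P.-integrable setT (fun w => (1 + X w ^+ 2)%:E).
  have i1 := finite_measure_integrable_cst P 1 measurableT.
  suff i2 : P.-integrable setT (fun w => (X w ^+ 2)%:E).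
    exact: (integrableD measurableT i1 i2).
  apply/integrableP; split; first exact/measurable_EFinP.
  under eq_integral do rewrite gee0_abs ?lee_fin ?sqr_ge0//.
  exact: le_lt_trans (heavy_tailed_second_moment _ _ _ _ _ _ q2 tailX) (ltry _).
apply: le_integrable iX2 => //; first exact/measurable_EFinP.
move=> w _ /=; rewrite lee_fin [leRHS]ger0_norm ?addr_ge0 ?sqr_ge0//.
rewrite -(real_normK (num_real (X w))).
have := sqr_ge0 (`|X w| - 1); nra.
Qed.

(** * Expectation of a product of functions of independent variables *)

Section ge0_integralM_indep.
Import HBNNSimple.

(** Passage from indicators to nonnegative functions of [X], through simple functions and monotone
    convergence. The hypothesis at the full set identifies [c] as the expectation of [G]. *)
Lemma ge0_integralM_indep (d : measure_display) (T : measurableType d)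
    (R : realType) (P : probability T R) (X : {RV P >-> R}) (G : T -> R)
    (c : R) (f : R -> R) :
  measurable_fun setT G -> (forall w, 0 <= G w) -> 0 <= c ->
  measurable_fun setT f -> (forall x, 0 <= f x) ->
  (forall A : set R, measurable A ->
    (\int[P]_w (\1_A (X w) * G w)%:E = c%:E * P (X @^-1` A))%E) ->
  (\int[P]_w (f (X w) * G w)%:E = c%:E * \int[P]_w (f (X w))%:E)%E.
Proof.
move=> mG G0 c0 mf f0 HA.
have mX : measurable_fun setT (X : T -> R) by [].
move/measurable_EFinP: (mf) => mEf.
pose g := nnsfun_approx measurableT mEf.
have gf x : EFin \o g^~ x @ \oo --> (f x)%:E.
  by apply: (cvg_nnsfun_approx measurableT mEf) => // y _ /=; rewrite lee_fin.
have gnd x m n : (m <= n)%N -> g m x <= g n x.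
  by move=> mn; exact/lefP/nd_nnsfun_approx.
have mgX n : measurable_fun setT (fun w => g n (X w)).
  by apply: (measurableT_comp (f := g n) (g := X)).
have mgXG n : measurable_fun setT (fun w => g n (X w) * G w).
  by apply: measurable_funM.
have L : (\int[P]_w (f (X w) * G w)%:E =
    limn (fun n => \int[P]_w (g n (X w) * G w)%:E))%E.
  rewrite -monotone_convergence//.
  - apply: eq_integral => w _; apply/esym/cvg_lim => //.
    under eq_fun do rewrite EFinM muleC.
    by rewrite EFinM muleC; apply: cvgeZl => //; exact: gf.
  - by move=> n; exact/measurable_EFinP.
  - by move=> n w _; rewrite lee_fin mulr_ge0.
  - by move=> w _ m n mn; rewrite lee_fin ler_wpM2r// gnd.
have Rl : (c%:E * \int[P]_w (f (X w))%:E =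
    limn (fun n => c%:E * \int[P]_w (g n (X w))%:E))%E.
  have -> : (\int[P]_w (f (X w))%:E =
      limn (fun n => \int[P]_w (g n (X w))%:E))%E.
    rewrite -monotone_convergence//.
    - by apply: eq_integral => w _; apply/esym/cvg_lim => //; exact: gf.
    - by move=> n; exact/measurable_EFinP.
    - by move=> n w _; rewrite lee_fin.
    - by move=> w _ m n mn; rewrite lee_fin gnd.
  rewrite -limeMl//; apply: (cvgP _ (cvg_monotone_convergence _ _ _ _)) => //.
  - by move=> n; exact/measurable_EFinP.
  - by move=> n w _; rewrite lee_fin.
  - by move=> w _ m n mn; rewrite lee_fin gnd.
rewrite L Rl; congr (limn _); apply/funext => n.
have mP r : measurable (g n @^-1` [set r]) by exact: measurable_funPTI.
have mPX r : measurable (X @^-1` (g n @^-1` [set r])).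
  by rewrite -[X in measurable X]setTI; exact: mX.
have mI r : measurable_fun setT (fun w => \1_(g n @^-1` [set r]) (X w) : R).
  exact: measurableT_comp (measurable_indic (mP r)) mX.
have HI r : (\int[P]_w (r * \1_(g n @^-1` [set r]) (X w))%:E =
    r%:E * P (X @^-1` (g n @^-1` [set r])))%E.
  rewrite (integralZl_indic _ (fun r => X @^-1` (g n @^-1` [set r])))//.
    by rewrite integral_indic// setIT.
  by move=> r0; rewrite preimage_nnfun0.
have r0P r w : 0 <= r * \1_(g n @^-1` [set r]) (X w).
  by have := nnfun_muleindic_ge0 (g n) r (X w); rewrite lee_fin.
(* Both sides are split over the level sets of the simple function [g n], where the hypothesis on
   indicators applies. *)
transitivity (\sum_(r \in range (g n))
    \int[P]_w (r * \1_(g n @^-1` [set r]) (X w) * G w)%:E)%E.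
  rewrite -ge0_integral_fsum//.
  - apply: eq_integral => w _; rewrite fsumEFin// fimfunE.
    by rewrite mulr_fsuml.
  - move=> r; apply/measurable_EFinP; apply: measurable_funM => //.
    exact: measurable_funM.
  - by move=> r w _; rewrite lee_fin mulr_ge0.
transitivity (c%:E * \sum_(r \in range (g n))
    \int[P]_w (r * \1_(g n @^-1` [set r]) (X w))%:E)%E; last first.
  congr (_ * _)%E; rewrite -ge0_integral_fsum//.
  - by apply: eq_integral => w _; rewrite fsumEFin// [in RHS]fimfunE.
  - by move=> r; apply/measurable_EFinP; exact: measurable_funM.
  - by move=> r w _; rewrite lee_fin.
rewrite ge0_mule_fsumr; last first.
  by move=> r; apply: integral_ge0 => w _; rewrite lee_fin.
apply: eq_fsbigr => r _; rewrite HI.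
(* A negative value has an empty level set, so both sides vanish; otherwise the scalar can be pulled
   out of a nonnegative integral. *)
have [r0|r0] := ltP r 0.
  rewrite preimage_nnfun0// preimage_set0 measure0 !mule0.
  by apply: integral0_eq => w _; rewrite indicE in_set0 mulr0 mul0r.
under eq_integral do rewrite -mulrA EFinM.
rewrite ge0_integralZl_EFin//.
- by rewrite HA// muleCA.
- by move=> w _; rewrite lee_fin mulr_ge0.
- by apply/measurable_EFinP; exact: measurable_funM.
Qed.

End ge0_integralM_indep.

(** Independence is stated for events, that is, for products of indicators; the Chernoff bound needs
    it for exponentials. *)
Lemma integral_prod_indep (d : measure_display) (T : measurableType d)
    (R : realType) (P : probability T R) (I : finType) (X : I -> {RV P >-> R})
    (f : I -> R -> R) (m : I -> R) :
  independent_RVs P X ->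
  (forall i, measurable_fun setT (f i)) -> (forall i x, 0 <= f i x) ->
  (forall i, \int[P]_w (f i (X i w))%:E = (m i)%:E)%E ->
  (\int[P]_w (\prod_i f i (X i w))%:E = (\prod_i m i)%:E)%E.
Proof.
move=> indX.
have mfX (g : I -> R -> R) i : measurable_fun setT (g i) ->
    measurable_fun setT (fun w => g i (X i w)).
  by move=> mg; exact: (measurableT_comp mg).
(* The indicators are replaced by general functions one coordinate at a time:
   only coordinates outside [s] are still required to be indicators. *)
suff H (s : seq I) (g : I -> R -> R) (mu : I -> R) :
    (forall i, measurable_fun setT (g i)) -> (forall i x, 0 <= g i x) ->
    (forall i, \int[P]_w (g i (X i w))%:E = (mu i)%:E)%E ->
    (forall i, i \notin s -> exists2 A, measurable A & g i = \1_A) ->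
    (\int[P]_w (\prod_i g i (X i w))%:E = (\prod_i mu i)%:E)%E.
  move=> mf f0 fm; apply: (H (enum I)) => // i.
  by rewrite mem_enum.
elim: s g mu => [|i s IH] g mu mg g0 gmu gA.
  (* With all factors indicators, their product is the indicator of an intersection, and
     independence for the full index set concludes. *)
  have /choice[A AP] : forall i, exists A, measurable A /\ g i = \1_A.
    by move=> i; have [//|A mA gE] := gA i; exists A.
  have mXA i : measurable (X i @^-1` A i).
    rewrite -[X in measurable X]setTI; apply: measurable_funPT => //.
    by have [] := AP i.
  rewrite -prodEFin; under [RHS]eq_bigr => i _.
    rewrite -gmu (AP i).2.
    under eq_integral do rewrite -[\1_(A i) (X i _)]/(\1_(X i @^-1` A i) _).
    rewrite integral_indic// setIT.
    over.
  have := indX [set: I]%SET A (fun i _ => (AP i).1).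
  under [RHS]eq_bigl do rewrite inE.
  move=> <-; rewrite -[in RHS](setIT (bigcap _ _)) -integral_indic//.
    apply: eq_integral => w _; congr (_%:E).
    under eq_bigr => i _ do rewrite (AP i).2 indicE.
    rewrite indicE; case: (boolP (w \in _)) => [|].
      rewrite inE => h; rewrite big1// => i _.
      by rewrite mem_set//; apply: h => /=; rewrite inE.
    move=> h; have [i Hi] : exists i, ~ A i (X i w).
      apply: contrapT => /forallNP h'; move/negP: h; apply; rewrite inE => i _.
      exact: contrapT (h' i).
    by rewrite (bigD1 i)//= memNset// mul0r.
  by apply: fin_bigcap_measurable => // i _; exact: mXA.
rewrite [in RHS](bigD1 i)//= mulrC EFinM -gmu.
under eq_integral do rewrite (bigD1 i)//=.
have mu0 j : 0 <= mu j.
  by rewrite -lee_fin -gmu integral_ge0// => w _; rewrite lee_fin.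
apply: ge0_integralM_indep => //.
- under eq_fun do rewrite big_mkcond /=.
  apply: (measurable_prod (h := fun j w => if j != i then g j (X j w) else 1)).
  by move=> j _; case: (j != i) => //; exact: mfX.
- by move=> w; rewrite prodr_ge0.
- by rewrite prodr_ge0.
(* Putting an indicator at coordinate [i] makes the induction hypothesis applicable, and it yields
   exactly the factorization required for the event that [X i] lies in [B]. *)
move=> B mB; pose g' j := if j == i then \1_B else g j.
have mXB : measurable (X i @^-1` B).
  by rewrite -[X in measurable X]setTI; exact: measurable_funPT.
pose mu' j := if j == i then fine (P (X i @^-1` B)) else mu j.
have mg' j : measurable_fun setT (g' j).
  by rewrite /g'; case: ifP => // _; exact: measurable_indic.
have g'0 j x : 0 <= g' j x by rewrite /g'; case: ifP.
have g'mu' j : (\int[P]_w (g' j (X j w))%:E = (mu' j)%:E)%E.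
  rewrite /g' /mu'; case: eqP => [->|//].
  rewrite fineK ?fin_num_measure//.
  under eq_integral do rewrite -[\1_B (X i _)]/(\1_(X i @^-1` B) _).
  by rewrite integral_indic// setIT.
have g'A j : j \notin s -> exists2 A, measurable A & g' j = \1_A.
  move=> js; rewrite /g'; case: eqP => [_|/eqP ji]; first by exists B.
  by apply: gA; rewrite inE negb_or ji.
have := IH g' mu' mg' g'0 g'mu' g'A.
have -> : \prod_i mu' i = fine (P (X i @^-1` B)) * \prod_(j | j != i) mu j.
  rewrite (bigD1 i)//= {1}/mu' eqxx; congr (_ * _).
  by apply: eq_bigr => j ji; rewrite /mu' (negPf ji).
rewrite mulrC EFinM fineK ?fin_num_measure// => <-.
apply: eq_integral => w _; rewrite [in RHS](bigD1 i)//= {1}/g' eqxx.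
by congr ((_ * _)%:E); apply: eq_bigr => j ji; rewrite /g' (negPf ji).
Qed.

(** * Exponential moments and the choice of the Chernoff parameter *)

(** The coefficient of l^2 a^2 in the exponential moment bound: the constant of the quadratic
    estimate at r = 2q times the second moment bound. *)
Definition variance_factor (R : realType) (q : R) : R :=
  expR (2 * q) * (8 / (1 - 2 `^ (2 - q))).

Lemma variance_factor_gt0 (R : realType) (q : R) : 2 < q ->
  0 < variance_factor R q.
Proof.
move=> q2; rewrite mulr_gt0 ?expR_gt0// divr_gt0// subr_gt0.
by rewrite /powR pnatr_eq0/= expR_lt1 pmulr_llt0 ?ln_gt0 ?ltr1n//; lra.
Qed.

Lemma measurable_expR_minr (R : realType) (l a M : R) :
  measurable_fun setT (fun x : R => expR (l * Num.min (a * x) M)).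
Proof.
apply: measurableT_comp => //; apply: measurable_funM => //.
by apply: measurable_minr => //; exact: measurable_funM.
Qed.

(** Integrate [expR_minr_le] at y = a X, bound the second and clipped moments, and finish with 1 + u
    <= e^u. The clipped moment is used with rho = (|a|/M)^q, since (|a X|/M)^q = rho |X|^q. *)
Lemma mgf_minr_le (d : measure_display) (T : measurableType d)
    (R : realType) (P : probability T R) (q : R) (X : {RV P >-> R})
    (a m l M : R) :
  2 < q -> heavy_tailed P q X -> (\int[P]_w (X w)%:E = m%:E)%E ->
  0 < l -> 0 < M ->
  (\int[P]_w (expR (l * Num.min (a * X w) M))%:E <=
   (expR (l * (a * m) + variance_factor R q * l ^+ 2 * a ^+ 2
          + 8 * expR (l * M) * (`|a| / M) `^ q))%:E)%E.
Proof.
move=> q2 tailX Xm l0 M0.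
have iX := heavy_tailed_integrable _ _ _ _ _ _ q2 tailX.
have rho0 : 0 <= (`|a| / M) `^ q by exact: powR_ge0.
set rho := (`|a| / M) `^ q in rho0 *.
have mX2 : measurable_fun setT (fun w => X w ^+ 2) by exact: measurable_funX.
pose W w := (Num.min 1 (rho * `|X w| `^ q)) ^+ 2.
have mW : measurable_fun setT W.
  apply: measurable_funX; apply: measurable_minr => //.
  apply: measurable_funM => //.
  apply: (measurableT_comp (measurable_powR q)) => //.
  exact: measurableT_comp.
have W0 w : 0 <= W w by exact: sqr_ge0.
pose F w := 1 + l * (a * X w) + expR (2 * q) * l ^+ 2 * (a * X w) ^+ 2
            + expR (l * M) * W w.
have expF w : expR (l * Num.min (a * X w) M) <= F w.
  apply: le_trans (expR_minr_le _ l (a * X w) M q l0 M0 ltac:(lra)) _.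
  rewrite le_eqVlt; apply/orP; left; apply/eqP.
  rewrite /F /W /rho normrM -powRM ?divr_ge0 ?(ltW M0)//.
  by rewrite [`|a| * _ / M]mulrAC.
have mF : measurable_fun setT F.
  by repeat (apply: measurable_funD => //);
     repeat (apply: measurable_funM => //);
     apply: measurable_funX => //; exact: measurable_funM.
apply: (@le_trans _ _ (\int[P]_w (F w)%:E)%E).
  apply: ge0_le_integral => //.
  - apply/measurable_EFinP.
    exact: (measurableT_comp (measurable_expR_minr R l a M)).
  - exact/measurable_EFinP.
  - by move=> w _; rewrite lee_fin.
have K2 := heavy_tailed_second_moment _ _ _ _ _ _ q2 tailX.
have K3 := heavy_tailed_clipped_moment _ _ _ _ _ _ _ q2 tailX rho0.
have iX2 : P.-integrable setT (fun w => (X w ^+ 2)%:E).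
  apply/integrableP; split; first exact/measurable_EFinP.
  under eq_integral do rewrite gee0_abs ?lee_fin ?sqr_ge0//.
  exact: le_lt_trans K2 (ltry _).
have iW : P.-integrable setT (fun w => (W w)%:E).
  apply/integrableP; split; first exact/measurable_EFinP.
  under eq_integral do rewrite gee0_abs ?lee_fin ?W0//.
  exact: le_lt_trans K3 (ltry _).
have i1 := finite_measure_integrable_cst P 1 measurableT.
have -> : (\int[P]_w (F w)%:E = \int[P]_w (1 + ((l * a)%:E * (X w)%:E +
    ((expR (2 * q) * l ^+ 2 * a ^+ 2)%:E * (X w ^+ 2)%:E +
    (expR (l * M))%:E * (W w)%:E))))%E.
  apply: eq_integral => w _; rewrite -!EFinM -!EFinD; congr (_%:E).
  by rewrite /F; ring.
have jX := integrableZl measurableT (l * a) iX.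
have jX2 := integrableZl measurableT (expR (2 * q) * l ^+ 2 * a ^+ 2) iX2.
have jW := integrableZl measurableT (expR (l * M)) iW.
have j2 := integrableD measurableT jX2 jW.
have j3 := integrableD measurableT jX j2.
rewrite (integralD measurableT i1 j3) (integralD measurableT jX j2).
rewrite (integralD measurableT jX2 jW) !integralZl//.
rewrite [X in (X + _ <= _)%E](_ : _ = 1%E); last first.
  by rewrite (integral_cst P measurableT 1%E) mul1e; exact: probability_setT.
rewrite Xm.
apply: (@le_trans _ _ (1 + ((l * a)%:E * m%:E +
   ((expR (2 * q) * l ^+ 2 * a ^+ 2)%:E * (8 / (1 - 2 `^ (2 - q)))%:E +
    (expR (l * M))%:E * (8 * rho)%:E)))%E).
  apply: leeD => //; apply: leeD => //; apply: leeD.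
    by apply: lee_wpmul2l => //; rewrite lee_fin mulr_ge0 ?sqr_ge0// mulr_ge0
      ?sqr_ge0 ?expR_ge0.
  by apply: lee_wpmul2l => //; rewrite lee_fin expR_ge0.
rewrite -!EFinM -!EFinD lee_fin.
apply: le_trans (expR_ge1Dx _).
rewrite le_eqVlt; apply/orP; left; apply/eqP.
by rewrite /variance_factor -/rho; ring.
Qed.

(* The witness is l = min(t / s, t^2 / (2 M)). *)
Lemma chernoff_parameter (R : realType) (V s t M : R) :
  0 < V -> 0 < s -> 0 < t -> 0 < M ->
  exists l, [/\ 0 < l, l * M <= t ^+ 2 / 2 &
    - (l * ((V + 1) * (t * s + M))) + V * l ^+ 2 * s ^+ 2 <= - (t ^+ 2 / 2)].
Proof.
move=> V0 s0 t0 M0.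
have t20 : 0 < t ^+ 2 by rewrite exprn_gt0.
(* Here l s = t, so the exponent is at most -(V + 1) t^2 + V t^2 = -t^2. *)
have [h|h] := leP (t / s) (t ^+ 2 / (2 * M)).
  exists (t / s); have ls : t / s * s = t by rewrite divfK ?gt_eqF.
  have l0 : 0 < t / s by rewrite divr_gt0.
  move: (t / s) h ls l0 => l h ls l0; split => //.
    by move: h; rewrite invfM mulrA ler_pdivlMr.
  have -> : l * ((V + 1) * (t * s + M)) = (V + 1) * t ^+ 2 + (V + 1) * (l * M).
    by rewrite [t ^+ 2](_ : _ = t * (l * s)); [ring|rewrite ls expr2].
  have -> : V * l ^+ 2 * s ^+ 2 = V * t ^+ 2 by rewrite -ls; ring.
  have : 0 <= (V + 1) * (l * M) by rewrite !mulr_ge0 ?ltW ?addr_gt0.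
  lra.
(* Here l M = t^2/2 and l s <= t: the quadratic term is absorbed by V (l s) t, and the summand l M
   supplies the required t^2/2. *)
exists (t ^+ 2 / (2 * M)).
have lM : t ^+ 2 / (2 * M) * M = t ^+ 2 / 2 by field; rewrite gt_eqF.
have l0 : 0 < t ^+ 2 / (2 * M) by rewrite divr_gt0 ?mulr_gt0.
move: (t ^+ 2 / (2 * M)) h lM l0 => l h lM l0; split => //; first by rewrite lM.
have ls : l * s <= t by rewrite -ler_pdivlMr// ltW.
have -> : l * ((V + 1) * (t * s + M)) =
    (V + 1) * (l * s) * t + V * (l * M) + l * M by ring.
have h1 : V * ((l * s) * (l * s)) <= V * ((l * s) * t).
  by rewrite ler_pM2l// ler_pM2l// mulr_gt0.
have -> : V * l ^+ 2 * s ^+ 2 = V * ((l * s) * (l * s)) by ring.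
have : 0 <= V * (l * M) by rewrite !mulr_ge0 ?ltW.
have : 0 <= l * s * t by rewrite !mulr_ge0 ?ltW.
rewrite -lM; lra.
Qed.

(** * Norms, the one-sided tail bound and the theorem *)

Lemma lp_normK (R : realType) (n : nat) (p : R) (a : 'rV[R]_n) : 0 < p ->
  lp_norm p a `^ p = \sum_(i < n) `|a 0 i| `^ p.
Proof.
move=> p0; rewrite /lp_norm -powRrM mulVf ?gt_eqF// powRr1//.
by apply: sumr_ge0 => i _; exact: powR_ge0.
Qed.

Lemma lp_norm_gt0 (R : realType) (n : nat) (p : R) (a : 'rV[R]_n) : a != 0 ->
  0 < lp_norm p a.
Proof.
move=> a0; apply: powR_gt0.
have [i ai] : exists i, a 0 i != 0.
  apply/existsP; apply: contraR a0 => /existsPn h.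
  by apply/eqP/rowP => i; rewrite mxE; apply/eqP; have := h i; rewrite negbK.
rewrite (bigD1 i)//= ltr_wpDr ?powR_gt0 ?normr_gt0//.
by apply: sumr_ge0 => j _; exact: powR_ge0.
Qed.

Lemma measure_bigsetU_le (d : measure_display) (T : measurableType d)
    (R : realType) (P : probability T R) (I : finType) (B : I -> set T) :
  (forall i, measurable (B i)) ->
  (P (\big[setU/set0]_i B i) <= \sum_i P (B i))%E.
Proof.
move=> mB; apply: proj2 (_ : measurable (\big[setU/set0]_i B i) /\ _).
elim/big_ind2 : _ => //.
- by rewrite measure0.
- move=> A x A' x' [mA Ax] [mA' Ax']; split; first exact: measurableU.
  by apply: le_trans (leeD Ax Ax'); exact: measureU2.
Qed.

(** In the constant, 2 pays for the event that some summand exceeds the truncation level, and e^8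
    for the Chernoff bound on the truncated sum. *)
Lemma upper_tail (R : realType) (n : nat) (q : R) (a : 'rV[R]_n)
    (d : measure_display) (T : measurableType d) (P : probability T R)
    (X : 'I_n -> {RV P >-> R}) (m : 'I_n -> R) (t : R) :
  2 < q -> a != 0 -> independent_RVs P X ->
  (forall i, heavy_tailed P q (X i)) ->
  (forall i, \int[P]_w (X i w)%:E = (m i)%:E)%E -> 0 < t ->
  (P [set w | ((variance_factor R q + 1) *
                (t * lp_norm 2 a + expR (t ^+ 2 / (2 * q)) * lp_norm q a) +
               \sum_i a 0 i * m i < \sum_i a 0 i * X i w)%R]
   <= ((2 + expR 8) * expR (- (t ^+ 2 / 2)))%:E)%E.
Proof.
move=> q2 a0 indX tailX Xm t0.
have q0 : 0 < q by lra.
set V := variance_factor R q; have V0 : 0 < V by exact: variance_factor_gt0.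
set s := lp_norm 2 a; have s0 : 0 < s by exact: lp_norm_gt0.
set N := lp_norm q a; have N0 : 0 < N by exact: lp_norm_gt0.
set M := expR _ * N; have M0 : 0 < M by rewrite mulr_gt0 ?expR_gt0.
have [l [l0 lM lV]] := chernoff_parameter R V s t M V0 s0 t0 M0.
set x := (V + 1) * (t * s + M) in lV *.
pose rho i := (`|a 0 i| / M) `^ q.
(* The level [M] is chosen for this identity: the sum is (N/M)^q. *)
have sum_rho : \sum_i rho i = expR (- (t ^+ 2 / 2)).
  transitivity (\sum_i `|a 0 i| `^ q * (M `^ q)^-1).
    apply: eq_bigr => i _.
    by rewrite /rho powRM ?invr_ge0 ?(ltW M0)// -powR_inv1 ?(ltW M0)//
      powRAC powR_inv1 ?powR_ge0.
  rewrite -mulr_suml -lp_normK// powRM ?expR_ge0 ?(ltW N0)// -/N.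
  have Nq0 : N `^ q != 0 by exact/lt0r_neq0/powR_gt0.
  rewrite invfM mulrCA divff// mulr1 -expRM -expRN.
  by congr (expR (- _)); field; rewrite gt_eqF.
have sum_sq : \sum_i a 0 i ^+ 2 = s ^+ 2.
  rewrite -powR_mulrn ?(ltW s0)// lp_normK//; apply: eq_bigr => i _.
  by rewrite powR_mulrn// real_normK ?num_real.
pose S w := \sum_i a 0 i * X i w.
pose Z w := \sum_i Num.min (a 0 i * X i w) M.
pose B i := [set w | M < a 0 i * X i w].
pose G := [set w | x + \sum_i a 0 i * m i <= Z w].
have mY i : measurable_fun setT (fun w => a 0 i * X i w).
  exact: measurable_funM.
have mB i : measurable (B i) by exact: measurable_preimage_gt.
have mG : measurable G.
  apply: measurable_preimage_ge; apply: measurable_sum => i.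
  exact: measurable_minr.
have mS : measurable_fun setT S by exact: measurable_sum.
(* Outside every [B i] the truncation changes nothing, so [Z] equals [S] there. *)
apply: (@le_trans _ _ (P (\big[setU/set0]_i B i `|` G))).
  apply: le_measure; rewrite ?inE.
  - exact: measurable_preimage_gt.
  - by apply: measurableU => //; exact: bigsetU_measurable.
  move=> w /= xS; have [[i Bi]|nB] := pselect (exists i, B i w).
    by left; rewrite -bigcup_seq; exists i => //=; rewrite mem_index_enum.
  right; rewrite /G/= (_ : Z w = S w) ?ltW//.
  apply: eq_bigr => i _; apply/min_idPl; rewrite leNgt; apply/negP => h.
  by apply: nB; exists i.
apply: (le_trans (measureU2 _ _ mG)); first exact: bigsetU_measurable.
rewrite mulrDl EFinD; apply: leeD.
  apply: (le_trans (measure_bigsetU_le _ _ _ _ _ _ mB)).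
  rewrite -sum_rho mulr_sumr -sumEFin; apply: lee_sum => i _.
  have [ai0|ai0] := eqVneq (a 0 i) 0.
    rewrite (_ : B i = set0) ?measure0 ?lee_fin ?mulr_ge0 ?powR_ge0//.
    by apply/seteqP; split => w //; rewrite /B/= ai0 mul0r; lra.
  have na0 : 0 < `|a 0 i| by rewrite normr_gt0.
  have Ma0 : 0 < M / `|a 0 i| by rewrite divr_gt0.
  (* [B i] forces |X_i| >= M/|a_i|, so the weak tail at that point gives 2 [rho i]. *)
  have -> : rho i = (M / `|a 0 i|) `^ (- q).
    by rewrite /rho -invf_div -powR_inv1 ?(ltW Ma0)// -powRrM mulN1r.
  apply: le_trans (weak_tail _ _ _ _ _ _ _ q2 (tailX i) Ma0).
  apply: le_measure; rewrite ?inE//; first exact: measurable_tail.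
  move=> w; rewrite /B/= ler_pdivrMr// mulrC -normrM => h.
  by rewrite (le_trans (ltW h))// mulrC ler_norm.
pose f i y := expR (l * Num.min (a 0 i * y) M).
pose E i := l * (a 0 i * m i) + V * l ^+ 2 * a 0 i ^+ 2
            + 8 * expR (l * M) * rho i.
have fE i : (\int[P]_w (f i (X i w))%:E <= (expR (E i))%:E)%E.
  exact: mgf_minr_le.
have f0 i : (0 <= \int[P]_w (f i (X i w))%:E)%E.
  by apply: integral_ge0 => w _; rewrite lee_fin expR_ge0.
pose mu i := fine (\int[P]_w (f i (X i w))%:E)%E.
have fmu i : (\int[P]_w (f i (X i w))%:E = (mu i)%:E)%E.
  by rewrite fineK// ge0_fin_numE// (le_lt_trans (fE i)) ?ltry.
have mf i : measurable_fun setT (f i) by exact: measurable_expR_minr.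
have prodE := integral_prod_indep _ _ _ P _ X f mu indX mf
  (fun i y => expR_ge0 _) fmu.
have mgfE : \prod_i mu i <= expR (\sum_i E i).
  rewrite expR_sum; apply: ler_prod => i _.
  by rewrite -!lee_fin -fmu f0 fE.
(* Markov's inequality for e^{l Z}, whose expectation factors by independence. *)
have markovG : ((expR (l * (x + \sum_i a 0 i * m i)))%:E * P G <=
    (\prod_i mu i)%:E)%E.
  rewrite -prodE -[G]setIT -integral_indic// -ge0_integralZl_EFin ?expR_ge0//;
    last exact/measurable_EFinP/measurable_indic.
  apply: ge0_le_integral => //.
  - by apply/measurable_EFinP; exact: measurable_funM.
  - apply/measurable_EFinP; apply: measurable_prod => i _.
    exact: (measurableT_comp (mf i)).
  move=> w _; rewrite -EFinM lee_fin -expR_sum -mulr_sumr -/(Z w) indicE.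
  case: (boolP (w \in G)) => [|_]; last by rewrite mulr0 expR_ge0.
  by rewrite inE mulr1 ler_expR ler_pM2l.
rewrite -(@lee_pmul2l _ (expR (l * (x + \sum_i a 0 i * m i)))%:E) ?lte_fin
  ?expR_gt0//.
apply: (le_trans markovG); rewrite -EFinM lee_fin -!expRD.
apply: (le_trans mgfE); rewrite ler_expR.
have -> : \sum_i E i = l * (\sum_i a 0 i * m i) + V * l ^+ 2 * s ^+ 2
    + 8 * (expR (l * M) * expR (- (t ^+ 2 / 2))).
  by rewrite !big_split/= -!mulr_sumr sum_sq sum_rho mulrA.
(* By l M <= t^2/2 the clipped terms total at most 8; the mean terms cancel and [lV] bounds the
   rest. *)
have : expR (l * M) * expR (- (t ^+ 2 / 2)) <= 1.
  by rewrite -expRD expR_le1; lra.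
rewrite mulrDr; lra.
Qed.

Theorem theorem1 (R : realType) :
  exists (C : R) (Cq : R -> R),
    0 < C /\
    (forall q : R, 2 < q -> 1 < Cq q) /\
    forall (n : nat) (q : R) (a : 'rV[R]_n)
      (d : measure_display) (T : measurableType d) (P : probability T R)
      (X : 'I_n -> {RV P >-> R}),
      2 < q ->
      a != 0 ->
      independent_RVs P X ->
      (forall (i : 'I_n) (t : R), 0 < t ->
        (P [set w | (t < `|X i w|)%R] <= (2 * (1 + t) `^ (- q))%:E)%E) ->
      let Y := fun w : T => \sum_(i < n) a 0 i * X i w in
      forall t : R, 0 < t ->
        (P [set w |
             (Cq q * (t * lp_norm 2 a + expR (t ^+ 2 / (2 * q)) * lp_norm q a))%:E
             < `| (Y w)%:E - 'E_P[Y] | ]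
         <= (C * expR (- (t ^+ 2 / 2)))%:E)%E.
Proof.
(* The factor 2 counts the upper and lower deviations; [chernoff_parameter] dictates the form of
   [Cq]. *)
exists (2 * (2 + expR 8)), (fun q => variance_factor R q + 1).
split; first by rewrite mulr_gt0// addr_gt0// expR_gt0.
split=> [q q2|]; first by rewrite ltrDr variance_factor_gt0.
move=> n q a d T P X q2 a0 indX tailX Y t t0.
have iX i := heavy_tailed_integrable _ _ _ _ _ (X i) q2 (tailX i).
pose m i := fine (\int[P]_w (X i w)%:E)%E.
have Xm i : (\int[P]_w (X i w)%:E = (m i)%:E)%E.
  by rewrite fineK// integrable_fin_num//; exact: iX.
have EY : ('E_P[Y] = (\sum_i a 0 i * m i)%:E)%E.
  rewrite unlock -sumEFin; under eq_integral do rewrite /Y -sumEFin.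
  rewrite integral_sum//; last first.
    by move=> i; exact: (integrableZl measurableT (a 0 i) (iX i)).
  apply: eq_bigr => i _; rewrite EFinM -Xm.
  exact: (integralZl measurableT (iX i)).
set x := _ * (t * _ + _); rewrite EY.
have mY : measurable_fun setT Y.
  by apply: measurable_sum => i; exact: measurable_funM.
pose U := [set w | x + \sum_i a 0 i * m i < Y w].
pose L := [set w | x + \sum_i (- a) 0 i * m i < \sum_i (- a) 0 i * X i w].
have mU : measurable U by exact: measurable_preimage_gt.
have mL : measurable L.
  apply: measurable_preimage_gt; apply: measurable_sum => i.
  exact: measurable_funM.
(* A lower deviation for [a] is an upper deviation for [- a], which has the same norms. *)
rewrite (_ : [set w | _] = U `|` L); last first.
  have Em : \sum_i (- a) 0 i * m i = - \sum_i a 0 i * m i.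
    by rewrite -sumrN; apply: eq_bigr => i _; rewrite mxE mulNr.
  have EL w : \sum_i (- a) 0 i * X i w = - Y w.
    by rewrite -sumrN; apply: eq_bigr => i _; rewrite mxE mulNr.
  apply/seteqP; split => w; rewrite /U /L /= Em EL lte_fin ltr_normr.
    by move=> /orP[h|h]; [left|right]; lra.
  by move=> [h|h]; apply/orP; [left|right]; lra.
apply: (le_trans (measureU2 _ mU mL)).
rewrite -mulrA mulr_natl mulr2n EFinD; apply: leeD.
  exact: upper_tail.
have Nnorm p : lp_norm p a = lp_norm p (- a).
  by congr (_ `^ _); apply: eq_bigr => i _; rewrite mxE normrN.
rewrite /L /x !Nnorm; apply: upper_tail => //.
by rewrite oppr_eq0.
Qed.
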